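(* Suppose the time-dependent directed graph $G(t)=(\{1,\dots,N\},E(t))$, $t\in\mathbb{Z}_{\ge 0}$, satisfies: there is an integer $Q\ge 1$ such that for every integer $t\ge 0$ the graph $\big(\{1,\dots,N\},\bigcup_{\tau=tQ}^{(t+1)Q-1}E(\tau)\big)$ is strongly connected. Suppose also that for each $t\in\mathbb{Z}_{\ge0}$ the weight matrix $W(t)=(w_{ik}(t))$ is column stochastic, i.e. $\sum_{i=1}^N w_{ik}(t)=1$ for every $k$, and that there is a constant $\alpha>0$ (independent of $t$) such that $w_{ii}(t)>\alpha$ and $w_{ik}(t)\in\{0\}\cup[\alpha,1]$ for all $i,k,t$. Then the sequences $\hat b^{\mathrm{hom}}_i(t)$ and $\hat\lambda^{\text{ad-hoc}}_i(t)$ generated by the ad-hoc distributed estimator satisfy, for every $i\in\{1,\dots,N\}$, $$\lim_{t\to\infty}\hat b^{\mathrm{hom}}_i(t)=\hat b^{\mathrm{hom}},\qquad \lim_{t\to\infty}\hat\lambda^{\text{ad-hoc}}_i(t)=\hat\lambda^{\text{ad-hoc}}_i .$$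
   Context: There are $N$ agents. Agent $i$ has collected $n_i\ge 1$ measurements $y_{i,1},\dots,y_{i,n_i}\in\mathbb{Z}_{\ge 0}$ (counts), and $\sigma_i=\sum_{\ell=1}^{n_i}y_{i,\ell}$, $n=\sum_{i=1}^N n_i$, $\sigma=\sum_{i=1}^N\sigma_i$. A constant $a>0$ is known to all agents. Define $$\hat b^{\mathrm{hom}}=\frac{\sigma}{an},\qquad \hat\lambda^{\text{ad-hoc}}_i=\frac{\hat b^{\mathrm{hom}}}{\hat b^{\mathrm{hom}}n_i+1}(a+\sigma_i).$$ Communication: $(k,i)\in E(t)$ means that agent $k$ communicates to agent $i$ at time $t$; the set of in-neighbors of $i$ at time $t$ is $N_i^I(t)=\{k:(k,i)\in E(t)\}$. The weights $w_{ik}(t)\ge 0$ satisfy $w_{ik}(t)>0$ if $k\in N_i^I(t)$ or $k=i$, and $w_{ik}(t)=0$ otherwise. Ad-hoc distributed estimator: initialize $s_i(0)=\sigma_i$, $\eta_i(0)=n_i$, $\hat b^{\mathrm{hom}}_i(0)=\sigma_i/(an_i)$, $\hat\lambda^{\text{ad-hoc}}_i(0)=\frac{\hat b^{\mathrm{hom}}_i(0)}{\hat b^{\mathrm{hom}}_i(0)n_i+1}(a+\sigma_i)$, and iterate for $t\ge 0$: $$s_i(t+1)=\sum_{k\in N_i^I(t)\cup\{i\}}w_{ik}(t)s_k(t),\qquad \eta_i(t+1)=\sum_{k\in N_i^I(t)\cup\{i\}}w_{ik}(t)\eta_k(t),$$ $$\hat b^{\mathrm{hom}}_i(t+1)=\frac1a\,\frac{s_i(t+1)}{\eta_i(t+1)},\qquad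 \hat\lambda^{\text{ad-hoc}}_i(t+1)=\frac{\hat b^{\mathrm{hom}}_i(t+1)}{\hat b^{\mathrm{hom}}_i(t+1)n_i+1}(a+\sigma_i).$$ *)

(* Defs.v *)
(* MathComp / MathComp-Analysis. *)
From HB Require Import structures.
From mathcomp Require Import all_boot all_order all_algebra.
From mathcomp Require Import all_classical all_reals all_analysis.

Set Implicit Arguments.
Unset Strict Implicit.
Unset Printing Implicit Defensive.

Import Order.TTheory GRing.Theory Num.Theory.
Import numFieldNormedType.Exports.

Local Open Scope ring_scope.

(* A directed graph on the finite vertex type T is given by its edge set;
   (k, i) is the edge from k to i. *)
Definition strongly_connected (T : finType) (A : {set T * T}) : Prop :=
  forall k i : T, connect (fun x y => (x, y) \in A) k i.

Definition in_neighbors (T : finType) (A : {set T * T}) (i : T) : {set T} :=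
  [set k | (k, i) \in A].

Definition edge_union (T : finType) (E : nat -> {set T * T}) (t1 t2 : nat) :
    {set T * T} :=
  (\bigcup_(t1 <= t < t2) E t)%SET.

Definition compatible_weights (R : realType) (N : nat)
    (A : {set 'I_N * 'I_N}) (W : 'M[R]_N) : Prop :=
  forall i k : 'I_N,
    [/\ 0 <= W i k,
        k \in in_neighbors A i \/ k = i -> 0 < W i k
      & ~ (k \in in_neighbors A i \/ k = i) -> W i k = 0].

Definition column_stochastic (R : realType) (N : nat) (W : 'M[R]_N) : Prop :=
  forall k : 'I_N, \sum_(i < N) W i k = 1.

Definition count_sum (N : nat) (n : 'I_N -> nat)
    (y : forall i : 'I_N, 'I_(n i) -> nat) (i : 'I_N) : nat :=
  (\sum_(l < n i) y i l)%N.

Definition bhom (R : realType) (N : nat) (a : R) (n : 'I_N -> nat)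
    (y : forall i : 'I_N, 'I_(n i) -> nat) : R :=
  (\sum_(i < N) count_sum y i)%N%:R / (a * (\sum_(i < N) n i)%N%:R).

(* The ad-hoc estimate of an agent with ni measurements of total si, when b is
   used as the value of the hyperparameter. *)
Definition lambda_of (R : realType) (a b : R) (ni si : nat) : R :=
  b / (b * ni%:R + 1) * (a + si%:R).

Definition lambda_adhoc (R : realType) (N : nat) (a : R) (n : 'I_N -> nat)
    (y : forall i : 'I_N, 'I_(n i) -> nat) (i : 'I_N) : R :=
  lambda_of a (bhom a y) (n i) (count_sum y i).

(* x_i(t+1) = sum of w_ik(t) x_k(t) over the in-neighbors k of i at time t and
   i itself; the iterations for s and eta differ only by x(0). *)
Fixpoint weighted_iter (R : realType) (N : nat)
    (E : nat -> {set 'I_N * 'I_N}) (w : nat -> 'M[R]_N) (x0 : 'I_N -> R)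
    (t : nat) (i : 'I_N) : R :=
  match t with
  | 0 => x0 i
  | t'.+1 => \sum_(k in in_neighbors (E t') i :|: [set i])
               w t' i k * weighted_iter E w x0 t' k
  end.

Definition s_dist (R : realType) (N : nat) (n : 'I_N -> nat)
    (y : forall i : 'I_N, 'I_(n i) -> nat)
    (E : nat -> {set 'I_N * 'I_N}) (w : nat -> 'M[R]_N) : nat -> 'I_N -> R :=
  weighted_iter E w (fun i => (count_sum y i)%:R).

Definition eta_dist (R : realType) (N : nat) (n : 'I_N -> nat)
    (E : nat -> {set 'I_N * 'I_N}) (w : nat -> 'M[R]_N) : nat -> 'I_N -> R :=
  weighted_iter E w (fun i => (n i)%:R).

Definition bhom_dist (R : realType) (N : nat) (a : R) (n : 'I_N -> nat)
    (y : forall i : 'I_N, 'I_(n i) -> nat)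
    (E : nat -> {set 'I_N * 'I_N}) (w : nat -> 'M[R]_N)
    (t : nat) (i : 'I_N) : R :=
  match t with
  | 0 => (count_sum y i)%:R / (a * (n i)%:R)
  | t'.+1 => a^-1 * (s_dist y E w t'.+1 i / eta_dist n E w t'.+1 i)
  end.

Definition lambda_dist (R : realType) (N : nat) (a : R) (n : 'I_N -> nat)
    (y : forall i : 'I_N, 'I_(n i) -> nat)
    (E : nat -> {set 'I_N * 'I_N}) (w : nat -> 'M[R]_N)
    (t : nat) (i : 'I_N) : R :=
  lambda_of a (bhom_dist a y E w t i) (n i) (count_sum y i).

(* Main.v *)
Require Import Defs.
From HB Require Import structures.
From mathcomp Require Import all_boot all_order all_algebra.
From mathcomp Require Import all_classical all_reals all_analysis.
From mathcomp Require Import lra.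

Set Implicit Arguments.
Unset Strict Implicit.
Unset Printing Implicit Defensive.

Import Order.TTheory GRing.Theory Num.Theory.
Import numFieldNormedType.Exports.

Local Open Scope classical_set_scope.
Local Open Scope ring_scope.

(** The two linear iterations preserve the total mass, since the weights are
column stochastic, so the common limit of the ratios [s_i / eta_i] has to be
[z = sum s / sum eta].  Put [e = s - z eta]: it follows the same iteration and
has total mass zero.  The idea is to measure [e] against [eta], that is, to
follow a number [m] with [|e_i(t)| <= m eta_i(t)] for all [i].

- Since the weights are nonnegative, [m eta + e] and [m eta - e] stay
  nonnegative once they are, so a bound [m] is never lost
  ([domination_later]).
- Over a window of [T = N Q] steps the mass held by any agent reaches every
  agent, and a fraction at least [alpha ^ T] of it survives: the set of agents
  reached grows strictly over each connected block until it is everything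
  ([spreading_covers], [mass_spreads]).  So each entry of a nonnegative
  trajectory ends up above a fixed fraction [c] of the total mass
  ([entry_ge_total]).
- Applied to [m eta + e] and [m eta - e], whose total mass is [m sum eta]
  because [sum e = 0], this gives [m eta_i - |e_i| >= c m sum eta >= c m eta_i]
  at the end of the window, so [m] shrinks by the factor [1 - c]
  ([domination_contracts]).

Hence [|s_i / eta_i - z| <= m (1 - c) ^ (t / T)], which tends to [0]
([ratio_cvg]).  How small the [eta_i(t)] may become does not matter, because [e]
is only ever compared with [eta] itself.  Finally, [b / (b n_i + 1) (a + sigma_i)]
is a continuous function of [b >= 0] ([lambda_of_cvg]). *)

(** * Spreading along jointly connected graphs *)

Lemma mem_edge_union (T : finType) (E : nat -> {set T * T}) (t1 t2 : nat)
    (u : T * T) :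
  u \in edge_union E t1 t2 -> exists2 t, (t1 <= t < t2)%N & u \in E t.
Proof.
rewrite /edge_union big_nat; elim/big_ind: _ => [|A B hA hB|t ht ut].
- by rewrite finset.in_set0.
- by rewrite finset.in_setU => /orP[/hA|/hB].
- by exists t.
Qed.

(** If the set did not grow over a block, it would be constant during the block
and hence closed under all edges of the union graph, so it would contain
everything reachable from [k]. *)
Lemma spreading_covers (T : finType) (E : nat -> {set T * T}) (Q : nat)
    (A : nat -> {set T}) (p : nat) (k : T) :
  (forall t, strongly_connected (edge_union E (t * Q)%N (t.+1 * Q)%N)) ->
  (forall t, (p * Q <= t)%N -> A t \subset A t.+1) ->
  (forall t j i, (p * Q <= t)%N -> (j, i) \in E t -> j \in A t -> i \in A t.+1) ->
  k \in A (p * Q)%N -> forall i, i \in A ((p + #|T|) * Q)%N.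
Proof.
move=> conn Amono Aedge kA.
have Ale t1 t2 : (p * Q <= t1)%N -> (t1 <= t2)%N -> A t1 \subset A t2.
  move=> pt1 /subnKC <-; elim: (t2 - t1)%N => [|d IH]; first by rewrite addn0.
  by rewrite addnS; apply: fintype.subset_trans IH (Amono _ (leq_trans pt1 (leq_addr _ _))).
have pm m : (p * Q <= (p + m) * Q)%N by rewrite leq_mul2r leq_addr orbT.
have blk m : ((p + m) * Q <= (p + m.+1) * Q)%N.
  by rewrite leq_mul2r addnS leqnSn orbT.
have grow m : (forall i, i \in A ((p + m) * Q)%N) \/ (m < #|A ((p + m) * Q)%N|)%N.
  elim: m => [|m IH].
    by right; rewrite addn0 card_gt0; apply/finset.set0Pn; exists k.
  have sub := Ale _ _ (pm m) (blk m).
  case: IH => [AT|IH]; first by left=> i; apply: (fintype.subsetP sub).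
  have [eqA|neA] := eqVneq (A ((p + m) * Q)%N) (A ((p + m.+1) * Q)%N); last first.
    right; apply: leq_ltn_trans IH _; apply: proper_card.
    by rewrite finset.properEneq neA.
  left; rewrite -eqA => i.
  have kB : k \in A ((p + m) * Q)%N by apply: (fintype.subsetP (Ale _ _ _ (pm m))) kA.
  (* An edge of the union graph is present at some time of the block, when the
     set has its constant value. *)
  have closedA x z : (x, z) \in edge_union E ((p + m) * Q)%N ((p + m).+1 * Q)%N ->
      x \in A ((p + m) * Q)%N -> z \in A ((p + m) * Q)%N.
    rewrite -addnS => /mem_edge_union[t /andP[lt tu] xz] xA.
    rewrite eqA; apply: (fintype.subsetP (Ale _ _ _ tu)).
      exact/leqW/(leq_trans (pm m)).
    apply: Aedge xz _; first exact: leq_trans (pm m) lt.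
    exact: (fintype.subsetP (Ale _ _ (pm m) lt)).
  have [q] := connectP (conn (p + m)%N k i).
  elim: q k kB {kA} => [|z q IHq] x xB /= => [_ ->//|/andP[xz zq]].
  by apply: IHq zq; apply: closedA xz xB.
move=> i; case: (grow #|T|) => [//|].
by rewrite ltnNge max_card.
Qed.

(** * Linear iterations with nonnegative column-stochastic weights *)

Definition trajectory (R : pzRingType) (N : nat) (w : nat -> 'M[R]_N)
    (x : nat -> 'I_N -> R) : Prop :=
  forall t i, x t.+1 i = \sum_k w t i k * x t k.

Lemma trajectory_comb (R : comPzRingType) (N : nat) (w : nat -> 'M[R]_N)
    (x y : nat -> 'I_N -> R) (b c : R) :
  trajectory w x -> trajectory w y ->
  trajectory w (fun t i => b * x t i + c * y t i).
Proof.
move=> hx hy t i; rewrite hx hy !mulr_sumr -big_split /=.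
by apply: eq_bigr => k _; rewrite mulrDr !mulrA ![w t i k * _]mulrC.
Qed.

Lemma weighted_iter_trajectory (R : realType) (N : nat)
    (E : nat -> {set 'I_N * 'I_N}) (w : nat -> 'M[R]_N) (x0 : 'I_N -> R) :
  (forall t, compatible_weights (E t) (w t)) ->
  trajectory w (weighted_iter E w x0).
Proof.
move=> hw t i /=; rewrite [RHS](bigID (mem (in_neighbors (E t) i :|: [set i])%SET)) /=.
rewrite [X in _ = _ + X]big1 ?addr0// => k kNi.
have [_ _ ->] := hw t i k; first by rewrite mul0r.
by move=> ki; move: kNi; rewrite finset.in_setU finset.in_set1;
  case: ki => [->|->]; rewrite ?eqxx ?orbT.
Qed.

Lemma trajectory_ge0 (R : numDomainType) (N : nat) (w : nat -> 'M[R]_N)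
    (x : nat -> 'I_N -> R) (t0 t : nat) :
  (forall t i k, 0 <= w t i k) -> trajectory w x ->
  (forall i, 0 <= x t0 i) -> (t0 <= t)%N -> forall i, 0 <= x t i.
Proof.
move=> w0 hx x0 /subnKC <-; elim: (t - t0)%N => [|d IH] i; first by rewrite addn0.
by rewrite addnS hx sumr_ge0// => k _; rewrite mulr_ge0.
Qed.

Lemma trajectory_total (R : realType) (N : nat) (w : nat -> 'M[R]_N)
    (x : nat -> 'I_N -> R) (t : nat) :
  (forall t, column_stochastic (w t)) -> trajectory w x ->
  \sum_i x t i = \sum_i x 0%N i.
Proof.
move=> hs hx; elim: t => // t <-.
under eq_bigr do rewrite hx.
by rewrite exchange_big /=; apply: eq_bigr => k _; rewrite -mulr_suml hs mul1r.
Qed.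

Lemma trajectory_step_ge (R : numDomainType) (N : nat) (w : nat -> 'M[R]_N)
    (x : nat -> 'I_N -> R) (t : nat) (i k : 'I_N) (alpha : R) :
  (forall t i k, 0 <= w t i k) -> trajectory w x -> (forall i, 0 <= x t i) ->
  alpha <= w t i k -> alpha * x t k <= x t.+1 i.
Proof.
move=> w0 hx x0 hwk; rewrite hx (bigD1 k)//=.
apply: (@le_trans _ _ (w t i k * x t k)); first by rewrite ler_wpM2r.
by rewrite lerDl sumr_ge0// => j _; rewrite mulr_ge0.
Qed.

Lemma trajectory_gt0 (R : numDomainType) (N : nat) (w : nat -> 'M[R]_N)
    (x : nat -> 'I_N -> R) (t : nat) (alpha : R) :
  (forall t i k, 0 <= w t i k) -> 0 < alpha ->
  (forall t i, alpha <= w t i i) -> trajectory w x ->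
  (forall i, 0 < x 0%N i) -> forall i, 0 < x t i.
Proof.
move=> w0 a0 wd hx x0; elim: t => // t IH i.
apply: lt_le_trans (trajectory_step_ge (alpha := alpha) (k := i) w0 hx _ _) => //.
  by rewrite mulr_gt0.
by move=> j; apply: ltW.
Qed.

(** The agents reached from [k] at time [t] are those holding at least
[alpha ^ (t - p Q)] times the initial mass of [k]: a self-loop keeps an agent in
this set, and an edge adds its head. *)
Lemma mass_spreads (R : realFieldType) (N : nat) (E : nat -> {set 'I_N * 'I_N})
    (w : nat -> 'M[R]_N) (Q : nat) (alpha : R) (x : nat -> 'I_N -> R) (p : nat) :
  (forall t, strongly_connected (edge_union E (t * Q)%N (t.+1 * Q)%N)) ->
  (forall t i k, 0 <= w t i k) -> 0 < alpha ->
  (forall t i, alpha <= w t i i) ->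
  (forall t k i, (k, i) \in E t -> alpha <= w t i k) ->
  trajectory w x -> (forall i, 0 <= x (p * Q)%N i) ->
  forall i k, alpha ^+ (N * Q) * x (p * Q)%N k <= x ((p + N) * Q)%N i.
Proof.
move=> conn w0 a0 wd we hx x0 i k.
pose A t := [set i | alpha ^+ (t - p * Q) * x (p * Q)%N k <= x t i]%SET.
have step t j l : (p * Q <= t)%N -> alpha <= w t l j -> j \in A t -> l \in A t.+1.
  rewrite !inE => pt wlj jA.
  apply: le_trans (trajectory_step_ge w0 hx (trajectory_ge0 w0 hx x0 pt) wlj).
  by rewrite subSn// exprS -mulrA ler_pM2l.
suff : i \in A ((p + #|'I_N|) * Q)%N by rewrite card_ord inE mulnDl addKn.
apply: (@spreading_covers _ E Q A p k conn).
- by move=> t pt; apply/fintype.subsetP => j; apply: step.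
- by move=> t j l pt jl; apply/step/we.
- by rewrite inE subnn mul1r.
Qed.

(** Each of the [N] agents contributes its own share, so the average of the
bounds of [mass_spreads] is a bound in terms of the total mass. *)
Lemma entry_ge_total (R : realFieldType) (N : nat)
    (E : nat -> {set 'I_N * 'I_N}) (w : nat -> 'M[R]_N) (Q : nat) (alpha : R)
    (x : nat -> 'I_N -> R) (p : nat) :
  (forall t, strongly_connected (edge_union E (t * Q)%N (t.+1 * Q)%N)) ->
  (forall t i k, 0 <= w t i k) -> 0 < alpha ->
  (forall t i, alpha <= w t i i) ->
  (forall t k i, (k, i) \in E t -> alpha <= w t i k) ->
  trajectory w x -> (forall i, 0 <= x (p * Q)%N i) ->
  forall i, alpha ^+ (N * Q) / N%:R * \sum_k x (p * Q)%N k
            <= x ((p + N) * Q)%N i.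
Proof.
move=> conn w0 a0 wd we hx x0 i.
have N0 : (0 : R) < N%:R by rewrite ltr0n (leq_ltn_trans _ (ltn_ord i)).
rewrite mulrAC ler_pdivrMr// mulr_sumr.
rewrite -[X in _ * X%:R]card_ord mulr_natr -sumr_const.
by apply: ler_sum => k _; apply: mass_spreads.
Qed.

(** * Contraction of the relative error *)

(** Both [m eta + e] and [m eta - e] are trajectories that are nonnegative at
time [t0], hence also later. *)
Lemma domination_later (R : realDomainType) (N : nat) (w : nat -> 'M[R]_N)
    (e eta : nat -> 'I_N -> R) (m : R) (t0 t : nat) :
  (forall t i k, 0 <= w t i k) -> trajectory w e -> trajectory w eta ->
  (forall i, `|e t0 i| <= m * eta t0 i) -> (t0 <= t)%N ->
  forall i, `|e t i| <= m * eta t i.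
Proof.
move=> w0 he heta dom t0t i.
have pos c : (forall j, 0 <= m * eta t0 j + c * e t0 j) ->
    0 <= m * eta t i + c * e t i.
  by move=> h; apply: (trajectory_ge0 w0 (trajectory_comb m c heta he) h t0t).
have := pos 1; have := pos (-1); rewrite !mulN1r !mul1r.
move=> hm hp; rewrite ler_norml; apply/andP; split.
  rewrite -subr_ge0 opprK addrC; apply: hp => j; rewrite mul1r.
  by have := dom j; rewrite ler_norml => /andP[]; rewrite -subr_ge0 opprK addrC.
rewrite -subr_ge0; apply: hm => j; rewrite mulN1r subr_ge0.
by have := dom j; rewrite ler_norml => /andP[].
Qed.

(** With [c = alpha ^ (N Q) / N], the trajectories [m eta + e] and [m eta - e] both
have total mass [m sum eta], so after one window all their entries are at least
[c m sum eta].  As [sum eta] is conserved and [eta] is nonnegative, it is at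
least [eta_i] at the end of the window, which turns this into the margin [c m eta_i]. *)
Lemma domination_contracts (R : realType) (N : nat)
    (E : nat -> {set 'I_N * 'I_N}) (w : nat -> 'M[R]_N) (Q : nat) (alpha : R)
    (e eta : nat -> 'I_N -> R) (p : nat) (m : R) :
  (forall t, strongly_connected (edge_union E (t * Q)%N (t.+1 * Q)%N)) ->
  (forall t i k, 0 <= w t i k) -> (forall t, column_stochastic (w t)) ->
  0 < alpha -> (forall t i, alpha <= w t i i) ->
  (forall t k i, (k, i) \in E t -> alpha <= w t i k) ->
  trajectory w e -> trajectory w eta -> (forall t i, 0 <= eta t i) ->
  \sum_i e 0%N i = 0 -> 0 <= m ->
  (forall i, `|e (p * Q)%N i| <= m * eta (p * Q)%N i) ->
  forall i, `|e ((p + N) * Q)%N i|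
            <= (1 - alpha ^+ (N * Q) / N%:R) * m * eta ((p + N) * Q)%N i.
Proof.
move=> conn w0 hs a0 wd we he heta eta0 sum_e m0 dom i.
set c := alpha ^+ (N * Q) / N%:R.
have c0 : 0 <= c by rewrite divr_ge0// exprn_ge0// ltW.
(* The total of [eta] is moved from the start to the end of the window. *)
have tot : m * c * eta ((p + N) * Q)%N i <= m * (c * \sum_k eta (p * Q)%N k).
  rewrite -mulrA ler_wpM2l// ler_wpM2l// (trajectory_total _ hs heta).
  rewrite -(trajectory_total ((p + N) * Q)%N hs heta) (bigD1 i)//= lerDl.
  by rewrite sumr_ge0.
have lower b : (forall j, 0 <= m * eta (p * Q)%N j + b * e (p * Q)%N j) ->
    m * c * eta ((p + N) * Q)%N i
      <= m * eta ((p + N) * Q)%N i + b * e ((p + N) * Q)%N i.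
  move=> h; apply: le_trans tot _.
  have := entry_ge_total conn w0 a0 wd we (trajectory_comb m b heta he) h i.
  rewrite /= big_split/= -!mulr_sumr (trajectory_total (p * Q)%N hs he) sum_e.
  by rewrite mulr0 addr0 mulrCA.
have {}dom j : - (m * eta (p * Q)%N j) <= e (p * Q)%N j <= m * eta (p * Q)%N j.
  by rewrite -ler_norml.
have lo := lower 1; have up := lower (-1).
rewrite ler_norml; apply/andP; split.
  have : forall j, 0 <= m * eta (p * Q)%N j + 1 * e (p * Q)%N j.
    by move=> j; have /andP[] := dom j; lra.
  by move=> /lo; lra.
have : forall j, 0 <= m * eta (p * Q)%N j + -1 * e (p * Q)%N j.
  by move=> j; have /andP[] := dom j; lra.
by move=> /up; lra.
Qed.

(** * Convergence of the ratios *)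

(** The error [e = s - z eta] has total mass zero, and windows of [N Q] steps
contract it relative to [eta] by [1 - c], so after [t] steps it is at most
[(1 - c) ^ (t %/ (N Q)) m0] times [eta]; at a time inside a window the bound from
its start still holds. *)
Lemma ratio_cvg (R : realType) (N : nat)
    (E : nat -> {set 'I_N * 'I_N}) (w : nat -> 'M[R]_N) (Q : nat) (alpha : R)
    (s eta : nat -> 'I_N -> R) :
  (0 < Q)%N ->
  (forall t, strongly_connected (edge_union E (t * Q)%N (t.+1 * Q)%N)) ->
  (forall t i k, 0 <= w t i k) -> (forall t, column_stochastic (w t)) ->
  0 < alpha -> (forall t i, alpha <= w t i i) ->
  (forall t k i, (k, i) \in E t -> alpha <= w t i k) ->
  trajectory w s -> trajectory w eta -> (forall i, 0 < eta 0%N i) ->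
  forall i, s t i / eta t i @[t --> \oo]
            --> (\sum_k s 0%N k) / \sum_k eta 0%N k.
Proof.
move=> Q0 conn w0 hs a0 wd we straj heta eta0 i.
have N0 : (0 < N)%N := leq_ltn_trans (leq0n i) (ltn_ord i).
have etat t := trajectory_gt0 t w0 a0 wd heta eta0.
set S := \sum_k eta 0%N k; set z := _ / S.
have S0 : 0 < S.
  rewrite /S (bigD1 i)//= ltr_pwDl// sumr_ge0// => k _; exact: ltW.
(* The factor [1] puts [e] in the form of [trajectory_comb]. *)
pose e t i := 1 * s t i + - z * eta t i.
have he : trajectory w e by exact: trajectory_comb.
have sum_e : \sum_k e 0%N k = 0.
  by rewrite big_split/= -!mulr_sumr mul1r mulNr divfK ?subrr// gt_eqF.
set c := alpha ^+ (N * Q) / N%:R.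
have c0 : 0 < c by rewrite divr_gt0 ?exprn_gt0// ltr0n.
have c1 : c <= 1.
  rewrite ler_pdivrMr ?ltr0n// mul1r.
  apply: (@le_trans _ _ 1); last by rewrite ler1n.
  rewrite exprn_ile1 ?(ltW a0)//; apply: le_trans (wd 0%N i) _.
  by rewrite -(hs 0%N i) (bigD1 i)//= lerDl sumr_ge0.
(* Any [m] dominating the error at time [0] serves as a start; this sum does. *)
pose m0 := \sum_k `|e 0%N k| / eta 0%N k.
have m00 : 0 <= m0 by rewrite sumr_ge0// => k _; rewrite divr_ge0// ltW.
have domN p j : `|e (p * N * Q)%N j| <= (1 - c) ^+ p * m0 * eta (p * N * Q)%N j.
  elim: p j => [|p IH] j.
    rewrite !mul0n expr0 mul1r -ler_pdivrMr// /m0 (bigD1 j)//= lerDl.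
    by rewrite sumr_ge0// => k _; rewrite divr_ge0// ltW.
  rewrite mulSnr exprS -2!mulrA [_ ^+ p * (_ * _)]mulrA mulrA.
  apply: (domination_contracts conn w0 hs a0 wd we he heta _ sum_e _ IH).
    by move=> t k; exact: ltW.
  by rewrite mulr_ge0// exprn_ge0// subr_ge0.
have NQ0 : (0 < N * Q)%N by rewrite muln_gt0 N0.
have dom t : `|s t i / eta t i - z| <= (1 - c) ^+ (t %/ (N * Q)) * m0.
  have -> : s t i / eta t i - z = e t i / eta t i.
    by rewrite /e mul1r mulrDl mulfK// gt_eqF.
  rewrite normf_div (gtr0_norm (etat t i)) ler_pdivrMr//.
  apply: (domination_later w0 he heta (domN _)).
  by rewrite -mulnA leq_trunc_div.
have bnd : (1 - c) ^+ (t %/ (N * Q)) * m0 @[t --> \oo] --> (0 : R).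
  rewrite -[X in _ --> X](mul0r m0); apply: cvgMl.
  apply: (@cvg_comp _ _ _ (fun t => t %/ (N * Q))%N (fun p => (1 - c) ^+ p) _ \oo).
    exact: cvg_divnr.
  by apply: cvg_expr; rewrite ger0_norm ?subr_ge0// ltrBlDr ltrDl.
apply/subr_cvg0; apply: norm_cvg0; apply: squeeze_cvgr (cvg_cst 0) bnd.
by apply: nearW => t; rewrite normr_ge0 dom.
Qed.

Lemma lambda_of_cvg (R : realType) (a b : R) (ni si : nat) (u : nat -> R) :
  0 <= b -> u t @[t --> \oo] --> b ->
  lambda_of a (u t) ni si @[t --> \oo] --> lambda_of a b ni si.
Proof.
move=> b0 ub; apply: cvgMl; apply: cvgM => //; apply: cvgV.
  by rewrite gt_eqF// ltr_wpDl// mulr_ge0.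
by apply: cvgD; [exact: cvgMl|exact: cvg_cst].
Qed.

Theorem mainTheorem1 (R : realType) (N : nat)
    (n : 'I_N -> nat) (hn : forall i : 'I_N, (1 <= n i)%N)
    (y : forall i : 'I_N, 'I_(n i) -> nat)
    (a : R) (ha : 0 < a)
    (E : nat -> {set 'I_N * 'I_N}) (w : nat -> 'M[R]_N)
    (hw : forall t : nat, compatible_weights (E t) (w t))
    (Q : nat) (hQ : (1 <= Q)%N)
    (hconn : forall t : nat,
      strongly_connected (edge_union E (t * Q)%N (t.+1 * Q)%N))
    (hstoch : forall t : nat, column_stochastic (w t))
    (alpha : R) (halpha : 0 < alpha)
    (hdiag : forall (t : nat) (i : 'I_N), alpha < w t i i)
    (hbound : forall (t : nat) (i k : 'I_N),
      w t i k = 0 \/ alpha <= w t i k <= 1) :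
  forall i : 'I_N,
    (bhom_dist a y E w t i @[t --> \oo] --> bhom a y) /\
    (lambda_dist a y E w t i @[t --> \oo] --> lambda_adhoc a y i).
Proof.
move=> i.
have w0 t j k : 0 <= w t j k by have [] := hw t j k.
have wd t j : alpha <= w t j j by exact: ltW.
have we t k j : (k, j) \in E t -> alpha <= w t j k.
  move=> kj; have [_ wpos _] := hw t j k.
  case: (hbound t j k) => [wjk|/andP[]//].
  by have := wpos (or_introl _); rewrite inE kj wjk ltxx => /(_ isT).
have eta0 j : (0 : R) < (n j)%:R by rewrite ltr0n.
(* At [t = 0] the estimate is defined by a separate formula with the same value. *)
have bE t : bhom_dist a y E w t i = a^-1 * (s_dist y E w t i / eta_dist n E w t i).
  by case: t => //=; rewrite invfM mulrCA.
have bcvg : bhom_dist a y E w t i @[t --> \oo] --> bhom a y.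
  rewrite (funext bE) /bhom invfM mulrCA !natr_sum; apply: cvgMr.
  by apply: (ratio_cvg hQ hconn w0 hstoch halpha wd we) => //;
    exact: weighted_iter_trajectory.
split=> //; apply: lambda_of_cvg bcvg.
by rewrite divr_ge0// mulr_ge0// ltW.
Qed.
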